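(* Let $G\le\mathrm{Sym}(\Omega)$, and suppose that $\Gamma,\Gamma'$ are distinct $G$-orbits in $\Omega$ on which the $G$-actions are permutationally equivalent relative to a bijection $f:\Gamma\to\Gamma'$. Let $\Omega':=\Omega\setminus\Gamma$, so $\Omega=\Omega'\cup\Gamma$. Then (a) both $G$ and $G^{(2),\Omega}$ act faithfully on $\Omega'$, and (b) the restriction $G^{(2),\Omega}|_{\Omega'}=G^{(2),\Omega'}$. (c) If $G$ is finite, then $G=G^{(2),\Omega}$ if and only if $G^{\Omega'}=G^{(2),\Omega'}$.
   Context: For a group $G$ acting on a set $\Gamma$, $G^\Gamma\le\mathrm{Sym}(\Gamma)$ is the induced permutation group, and $G^{(2),\Gamma}$ is the $2$-closure of $G^\Gamma$: the group of all $g\in\mathrm{Sym}(\Gamma)$ leaving invariant each $G$-orbit in $\Gamma\times\Gamma$. Actions of $G$ on $\Gamma$ and $\Gamma'$ are permutationally equivalent (relative to $f$) if $f:\Gamma\to\Gamma'$ is a bijection such that $(\gamma^g)f=(\gamma f)^g$ for all $\gamma\in\Gamma$, $g\in G$. *)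

(* Defs.v *)
From HB Require Import structures.
From mathcomp Require Import all_boot.
From mathcomp Require Import boolp classical_sets functions cardinality.

Set Implicit Arguments.
Unset Strict Implicit.
Unset Printing Implicit Defensive.

Local Open Scope classical_set_scope.

(* Sym(T) for an arbitrary, possibly infinite, type T; mathcomp's {perm T}
   requires a finType. *)
Record sym (T : Type) := Sym { sym_fun :> T -> T; sym_bij : bijective sym_fun }.

HB.instance Definition _ (T : Type) := gen_eqMixin (sym T).
HB.instance Definition _ (T : Type) := gen_choiceMixin (sym T).

Section SymGroup.
Variable T : Type.
Implicit Types g h k : sym T.

Lemma symP g h : g =1 h -> g = h.
Proof.
case: g h => [g gb] [h hb] /= /funext gh; rewrite gh in gb *.
by congr Sym; exact: Prop_irrelevance.
Qed.

Lemma sym_inv_subproof g : exists g' : T -> T, cancel g g' /\ cancel g' g.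
Proof. by have [g' gK g'K] := sym_bij g; exists g'. Qed.

Definition sym_inv_fun g : T -> T := sval (cid (sym_inv_subproof g)).

Lemma sym_invK g : cancel g (sym_inv_fun g).
Proof. by rewrite /sym_inv_fun; case: cid => g' []. Qed.

Lemma sym_Kinv g : cancel (sym_inv_fun g) g.
Proof. by rewrite /sym_inv_fun; case: cid => g' []. Qed.

Lemma sym_inv_bij g : bijective (sym_inv_fun g).
Proof. exact: Bijective (sym_Kinv g) (sym_invK g). Qed.

Definition sym_one : sym T := Sym (Bijective (frefl id) (frefl id)).
Definition sym_inv g : sym T := Sym (sym_inv_bij g).
(* Permutations act on the right, as for {perm T}: x^(g h) = (x^g)^h. *)
Definition sym_mul g h : sym T := Sym (bij_comp (sym_bij h) (sym_bij g)).

Lemma sym_mulA : associative sym_mul.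
Proof. by move=> g h k; exact: symP. Qed.

Lemma sym_mul1 : left_id sym_one sym_mul.
Proof. by move=> g; exact: symP. Qed.

Lemma sym_mulr1 : right_id sym_one sym_mul.
Proof. by move=> g; exact: symP. Qed.

Lemma sym_mulV : left_inverse sym_one sym_inv sym_mul.
Proof. by move=> g; apply: symP => x /=; rewrite sym_Kinv. Qed.

Lemma sym_mulrV : right_inverse sym_one sym_inv sym_mul.
Proof. by move=> g; apply: symP => x /=; rewrite sym_invK. Qed.

End SymGroup.

HB.instance Definition _ (T : Type) :=
  isGroup.Build (sym T) (@sym_mulA T) (@sym_mul1 T) (@sym_mulr1 T)
    (@sym_mulV T) (@sym_mulrV T).

Section PermutationGroups.
Variable T : Type.
Implicit Types (G : set (sym T)) (D : set T) (g : sym T).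

Definition subgroup G : Prop := group_closed [in G].

Definition orbits G : set (set T) :=
  [set O | exists x, O = [set g x | g in G]].

Definition pair_act g (p : T * T) : T * T := (g p.1, g p.2).

Definition orbitals G : set (set (T * T)) :=
  [set O | exists p, O = [set pair_act g p | g in G]].

Definition two_closure G : set (sym T) :=
  [set g | forall O, orbitals G O -> pair_act g @` O = O].

Definition invariant G D : Prop := forall g, G g -> g @` D = D.

Definition acts_faithfully G D : Prop :=
  invariant G D /\
  forall g, G g -> (forall x, D x -> g x = x) -> g = 1%g.

(* When D is G-invariant, this is the group G^D of permutations induced by G
   on D, i.e. the restriction of G to D; in general, only the g in G that
   stabilise D contribute an element. *)
Definition induced G D : set (sym D) :=
  [set h | exists2 g, G g & forall x : D, \val (h x) = g (\val x)].

(* f : T -> T stands for a map D -> D': only its values on D matter. *)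
Definition perm_equivalent G D D' (f : T -> T) : Prop :=
  set_bij D D' f /\ forall g x, G g -> D x -> f (g x) = g (f x).

Lemma two_closure_subgroup G : subgroup (two_closure G).
Proof.
split; first by rewrite inE => O _; rewrite -[RHS]image_id; apply: eq_imagel => -[].
move=> g h; rewrite !inE => gG hG O OG.
have hK : pair_act h^-1%g @` O = O.
  rewrite -[in LHS](hG _ OG) image_comp -[RHS]image_id.
  by apply: eq_imagel => -[x y] _ /=; rewrite /pair_act /= !sym_invK.
rewrite -[RHS]hK -[in RHS](gG _ OG) image_comp.
by apply: eq_imagel => -[].
Qed.

End PermutationGroups.

Arguments induced {T} G D _.

(* Main.v *)
Require Import Defs.
From mathcomp Require Import all_boot.
From mathcomp Require Import boolp classical_sets functions cardinality.

Set Implicit Arguments.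
Unset Strict Implicit.
Unset Printing Implicit Defensive.

Local Open Scope classical_set_scope.

(** Let [s] be the identity on [~` Gamma] and [f] on [Gamma].  It is a
    [G]-equivariant retraction of [Omega] onto [~` Gamma], injective on each
    [G]-orbit, so that for [h] in [G] the value [h x] is determined by
    [h (s x)].  Hence a permutation in the 2-closure is determined by its
    restriction to [~` Gamma], and a permutation [k] in the 2-closure of the
    induced group extends to [Omega] by sending [x] to [h x] for any [h] in [G]
    which agrees with [k] at [s x]. *)

Section Subgroup.
Variables (T : Type) (G : set (sym T)).
Hypothesis Gsub : subgroup G.

Lemma subgroup1 : G 1%g.
Proof. by case: Gsub; rewrite inE. Qed.

Lemma subgroupV g : G g -> G g^-1%g.
Proof.
case: Gsub => G1 Gdiv /mem_set Gg.
by have := Gdiv _ _ G1 Gg; rewrite mul1g inE.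
Qed.

Lemma subgroupM g h : G g -> G h -> G (g * h)%g.
Proof.
move=> Gg /subgroupV/mem_set Gh; have [_ Gdiv] := Gsub.
by have := Gdiv _ _ (mem_set Gg) Gh; rewrite invgK inE.
Qed.

(** An orbital is the orbit of any pair in it, so preserving all orbitals amounts to moving each
    pair within its own orbit. This pointwise form is the one used everywhere below. *)
Lemma two_closureP g :
  two_closure G g <-> forall x y, exists2 h, G h & h x = g x /\ h y = g y.
Proof.
split=> [Cg x y|Cg O [[x y] ->]].
  pose O := [set pair_act h (x, y) | h in G].
  have : (pair_act g @` O) (g x, g y).
    by exists (x, y) => //; exists 1%g; first exact: subgroup1.
  by rewrite Cg; [case=> h Gh [hx hy]; exists h | exists (x, y)].
apply/seteqP; split=> [_ [_ [h Gh <-] <-]|_ [h Gh <-]].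
  have [k Gk [/= kx ky]] := Cg (h x) (h y).
  by exists (h * k)%g; [exact: subgroupM | rewrite /pair_act /= kx ky].
(* For the reverse inclusion, [k] in [G] agrees with [g] on the [g]-preimage of the pair
   [(h x, h y)]; hence [k^-1] carries that pair to its preimage, which therefore lies in the same
   orbital. *)
have [k Gk [/= kx ky]] := Cg (g^-1%g (h x)) (g^-1%g (h y)).
exists (pair_act g^-1%g (pair_act h (x, y))); last first.
  by rewrite /pair_act /= !sym_Kinv.
exists (h * k^-1)%g; first exact/subgroupM/subgroupV.
rewrite !sym_Kinv in kx ky.
by rewrite /pair_act /= -{1}kx -{1}ky !sym_invK.
Qed.

Lemma sub_two_closure : G `<=` two_closure G.
Proof. by move=> g Gg; apply/two_closureP => x y; exists g. Qed.

Lemma invariantP (D : set T) :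
  (forall g x, G g -> D x -> D (g x)) -> Defs.invariant G D.
Proof.
move=> GD g Gg; apply/seteqP; split=> [_ [x Dx <-]|x Dx]; first exact: GD.
by exists (g^-1%g x); [apply: GD => //; exact: subgroupV | exact: sym_Kinv].
Qed.

Lemma orbit_closed O g x : orbits G O -> G g -> O x -> O (g x).
Proof.
move=> [a ->] Gg [h Gh <-].
by exists (h * g)%g => //; exact: subgroupM.
Qed.

Lemma orbit_eq O x : orbits G O -> O x -> O = [set g x | g in G].
Proof.
move=> [a ->] [h Gh <-]; apply/seteqP; split=> _ [g Gg <-].
  exists (h^-1 * g)%g; first by apply: subgroupM => //; exact: subgroupV.
  by rewrite /= sym_invK.
by exists (h * g)%g => //; exact: subgroupM.
Qed.

End Subgroup.

Lemma sym_restrict (T : Type) (D : set T) (g : sym T) :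
  g @` D = D -> exists h : sym D, forall x : D, \val (h x) = g (\val x).
Proof.
move=> gD; have gDx (x : D) : D (g (\val x)).
  by rewrite -{1}gD; exists (\val x) => //; exact/set_mem/valP.
pose h (x : D) : D := SigSub (mem_set (gDx x)).
have h_bij : bijective h.
  rewrite -setTT_bijective; split=> // [x y _ _ [/(bij_inj (sym_bij g))]|y _].
    exact: val_inj.
  have : D (\val y) by exact/set_mem/valP.
  rewrite -{1}gD => -[x Dx gx].
  by exists (SigSub (mem_set Dx)) => //; exact: val_inj.
by exists (Sym h_bij).
Qed.

(** Makes [two_closureP] available for the induced group. *)
Lemma induced_subgroup (T : Type) (G : set (sym T)) (D : set T) :
  subgroup G -> subgroup (induced G D).
Proof.
move=> Gsub; split; first by rewrite inE; exists 1%g => //; exact: subgroup1.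
move=> h k; rewrite !inE => -[g Gg hg] [l Gl kl].
exists (g * l^-1)%g; first by apply: subgroupM => //; exact: subgroupV.
move=> x /=; rewrite -hg -[in RHS](sym_Kinv k (h x)) kl.
by rewrite sym_invK.
Qed.

Section Retraction.
Variables (T : Type) (G : set (sym T)) (D : set T) (s : T -> T).
Hypothesis Gsub : subgroup G.
Hypothesis sD : forall x, D (s x).
Hypothesis s_id : forall x, D x -> s x = x.
Hypothesis s_equiv : forall g x, G g -> s (g x) = g (s x).
Hypothesis s_inj : forall g x, G g -> s (g x) = s x -> g x = x.

(** The element [g * h^-1] fixes [s x], so by equivariance it moves [x] to a point with the same
    retract; injectivity of [s] on the orbit makes it fix [x]. *)
Lemma eq_at_retract g h x : G g -> G h -> g (s x) = h (s x) -> g x = h x.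
Proof.
move=> Gg Gh gh; apply: (can_inj (sym_Kinv h)).
rewrite -[LHS]/((g * h^-1)%g x) [in RHS]sym_invK.
have Ggh : G (g * h^-1)%g by apply: subgroupM => //; exact: subgroupV.
by apply: s_inj => //; rewrite s_equiv //= gh sym_invK.
Qed.

Lemma eq_two_closure_on g h :
  two_closure G g -> two_closure G h -> (forall x, D x -> g x = h x) -> g = h.
Proof.
move=> /(two_closureP Gsub) Cg /(two_closureP Gsub) Ch gh; apply: symP => x.
(* Testing the closure on the pair [(x, s x)] ties the value at [x] to the value at [s x], which
   lies in [D]. *)
have [k Gk [<- ks]] := Cg x (s x); have [l Gl [<- ls]] := Ch x (s x).
by apply: eq_at_retract => //; rewrite ks ls gh.
Qed.

Lemma two_closure_invariant : Defs.invariant (two_closure G) D.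
Proof.
apply: invariantP => [|g x /(two_closureP Gsub) Cg Dx].
  exact: two_closure_subgroup.
have [h Gh [<- _]] := Cg x x.
by rewrite -(s_id Dx) -s_equiv.
Qed.

Lemma two_closure_faithful : acts_faithfully (two_closure G) D.
Proof.
split=> [|g Cg gD]; first exact: two_closure_invariant.
by apply: eq_two_closure_on => //; exact: sub_two_closure (subgroup1 _).
Qed.

Lemma faithful : acts_faithfully G D.
Proof.
have [CD Cfaith] := two_closure_faithful.
by split=> g /(sub_two_closure Gsub) Cg; [exact: CD | exact: Cfaith].
Qed.

Lemma induced_two_closure_sub :
  induced (two_closure G) D `<=` two_closure (induced G D).
Proof.
move=> k [g /(two_closureP Gsub) Cg kg].
apply/(two_closureP (induced_subgroup D Gsub)) => x y.
have [h Gh [hx hy]] := Cg (\val x) (\val y).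
have [l lh] := sym_restrict (faithful.1 _ Gh).
by exists l; [exists h | split; apply: val_inj; rewrite lh kg].
Qed.

Lemma two_closure_induced_sub :
  two_closure (induced G D) `<=` induced (two_closure G) D.
Proof.
move=> k /(two_closureP (induced_subgroup D Gsub)) Ck.
(* [r] is [s] with values in the subtype [D], on which [k] acts. *)
pose r x : D := SigSub (mem_set (sD x)).
have Ckr x y : exists2 h, G h & h (s x) = \val (k (r x)) /\
                               h (s y) = \val (k (r y)).
  have [l [h Gh lh] [lx ly]] := Ck (r x) (r y).
  by exists h => //; rewrite -lx -ly !lh.
(* By [eq_at_retract], the value [h x] is the same for every admissible [h], so it may serve as
   [g x]. *)
have /choice[g gP] x : exists y,
    forall h, G h -> h (s x) = \val (k (r x)) -> h x = y.
  have [h Gh [hx _]] := Ckr x x.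
  by exists (h x) => l Gl lx; apply: eq_at_retract => //; rewrite lx hx.
(* A single [h] is admissible for both points; this gives injectivity of [g] as well as its
   membership in the 2-closure. *)
have Cg x y : exists2 h, G h & h x = g x /\ h y = g y.
  by have [h Gh [hx hy]] := Ckr x y; exists h => //; split; exact: gP.
have g_bij : bijective g.
  rewrite -setTT_bijective; split=> // [x y _ _|y _].
    by have [h _ [<- <-]] := Cg x y; exact: (bij_inj (sym_bij h)).
  (* Surjectivity: choose [h] agreeing with [k] at [k^-1 (r y)], so that [h] sends this point to
     [s y]. Then [h^-1 y] retracts onto it, [h] is admissible at [h^-1 y], and [g] maps [h^-1 y] to
     [y]. *)
  have [l [h Gh lh] [lz _]] := Ck (k^-1%g (r y)) (k^-1%g (r y)).
  have hz : h (\val (k^-1%g (r y))) = s y by rewrite -lh lz sym_Kinv.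
  have rx : r (h^-1%g y) = k^-1%g (r y).
    apply: val_inj; rewrite -[LHS]/(s (h^-1%g y)) s_equiv; last exact: subgroupV.
    by rewrite -hz /= sym_invK.
  exists (h^-1%g y) => //; rewrite -(gP _ _ Gh) ?sym_Kinv // rx sym_Kinv /=.
  by rewrite -hz -rx.
exists (Sym g_bij); first exact/(two_closureP Gsub).
move=> x; have Dx : D (\val x) by exact/set_mem/valP.
have rx : r (\val x) = x by apply: val_inj; exact: s_id.
have [h Gh [hx _]] := Ckr (\val x) (\val x).
by rewrite /= -(gP _ _ Gh hx) -(s_id Dx) hx rx.
Qed.

Lemma induced_two_closure :
  induced (two_closure G) D = two_closure (induced G D).
Proof.
by apply/seteqP; split;
  [exact: induced_two_closure_sub | exact: two_closure_induced_sub].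
Qed.

Lemma two_closed_induced :
  G = two_closure G <-> induced G D = two_closure (induced G D).
Proof.
rewrite -induced_two_closure; split=> [<- //|GC].
apply/seteqP; split=> [|g Cg]; first exact: sub_two_closure.
(* The restriction of [g] to [D] is also induced by some [h] in [G], and elements of the 2-closure
   that agree on [D] are equal. *)
have [k kg] := sym_restrict (two_closure_invariant Cg).
have [h Gh kh] : induced G D k by rewrite GC; exists g.
suff -> : g = h by [].
apply: eq_two_closure_on => //; first exact: sub_two_closure.
move=> x Dx; pose y : D := SigSub (mem_set Dx).
by rewrite -[x]/(\val y) -kg kh.
Qed.

End Retraction.

Theorem theorem8p1 (Omega : Type) (G : set (sym Omega))
    (Gamma Gamma' : set Omega) (f : Omega -> Omega) :
  subgroup G ->
  orbits G Gamma -> orbits G Gamma' -> Gamma <> Gamma' ->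
  perm_equivalent G Gamma Gamma' f ->
  let Omega' : set Omega := ~` Gamma in
  [/\ acts_faithfully G Omega' /\ acts_faithfully (two_closure G) Omega',
      induced (two_closure G) Omega' = two_closure (induced G Omega')
    & finite_set G ->
      (G = two_closure G <->
       induced G Omega' = two_closure (induced G Omega'))].
Proof.
move=> Gsub oG oG' neq [[fG f_inj _] f_equiv] Omega'.
pose s x := if x \in Gamma then f x else x.
have GammaE g x : G g -> (g x \in Gamma) = (x \in Gamma).
  move=> Gg; apply/idP/idP; rewrite !inE; last exact: (orbit_closed Gsub oG).
  move=> /(orbit_closed Gsub oG (subgroupV Gsub Gg)).
  by rewrite /= sym_invK.
have sO x : Omega' (s x).
  rewrite /s; case: ifPn => [/set_mem Gx Gfx|/negP nGx Gx].
    (* If [f x] were in [Gamma], its orbit would be both [Gamma] and [Gamma']. *)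
    apply: neq; rewrite (orbit_eq Gsub oG Gfx).
    by rewrite (orbit_eq Gsub oG' (fG _ Gx)).
  by apply: nGx; rewrite inE.
have s_id x : Omega' x -> s x = x.
  by rewrite /s; case: ifPn => // /set_mem.
have s_equiv g x : G g -> s (g x) = g (s x).
  move=> Gg; rewrite /s GammaE //; case: ifPn => // /set_mem.
  exact: f_equiv.
(* Since [g] preserves [Gamma], both points fall in the same case: injectivity of [f] on [Gamma],
   the identity elsewhere. *)
have s_inj g x : G g -> s (g x) = s x -> g x = x.
  move=> Gg; rewrite /s GammaE //; case: ifPn => // Gx.
  by apply: f_inj => //; rewrite GammaE.
split; last by move=> _; exact: (two_closed_induced Gsub sO).
  by split; [exact: (faithful Gsub sO) | exact: (two_closure_faithful Gsub sO)].
exact: (induced_two_closure Gsub sO).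
Qed.
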